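(* Let $\mathcal{X}$ be a Banach space over $\mathbb{K}$ and let $(\{f_n\}_n,\{\tau_n\}_n)$ be an approximate Bessel sequence for $\mathcal{X}$. Then the following are equivalent: (i) $(\{f_n\}_n,\{\tau_n\}_n)$ can be expanded to an approximate Schauder frame (ASF) for $\mathcal{X}$. (ii) $\mathcal{X}$ has the reconstruction property.
   Context: $\mathbb{K}$ is $\mathbb{R}$ or $\mathbb{C}$, $\mathcal{X}^*$ is the continuous dual of $\mathcal{X}$, and sequences are indexed by $n\in\mathbb{N}=\{1,2,\dots\}$. Let $\{\tau_n\}_n$ be a sequence in $\mathcal{X}$ and $\{f_n\}_n$ a sequence in $\mathcal{X}^*$. The pair $(\{f_n\}_n,\{\tau_n\}_n)$ is an approximate Bessel sequence for $\mathcal{X}$ if $S_{f,\tau}:\mathcal{X}\to\mathcal{X}$, $S_{f,\tau}x := \sum_{n=1}^\infty f_n(x)\tau_n$, is a well-defined (the series converges in norm for every $x$) bounded linear operator. It is an approximate Schauder frame (ASF) for $\mathcal{X}$ if $S_{f,\tau}$ (called the frame operator) is a well-defined bounded linear invertible operator. The pair $(\{f_n\}_n,\{\tau_n\}_n)$ can be expanded to an ASF for $\mathcal{X}$ if there exist a sequence $\{g_n\}_n$ in $\mathcal{X}^*$ and a sequence $\{\omega_n\}_n$ in $\mathcal{X}$ such that $(\{f_n\}_n\cup\{g_n\}_n,\{\tau_n\}_n\cup\{\omega_n\}_n)$ is an ASF for $\mathcal{X}$, where the frame operator of this pair is $x\mapsto \sum_{n=1}^\infty f_n(x)\tau_n+\sum_{n=1}^\infty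 g_n(x)\omega_n$; that is, this map is a well-defined bounded linear invertible operator on $\mathcal{X}$. $\mathcal{X}$ has the reconstruction property if there exist a sequence $\{\tau_n\}_n$ in $\mathcal{X}$ and a sequence $\{f_n\}_n$ in $\mathcal{X}^*$ such that $x=\sum_{n=1}^\infty f_n(x)\tau_n$ (norm convergence) for all $x\in\mathcal{X}$. *)

(* Defs.v *)
From mathcomp Require Export all_boot all_order all_algebra.
From mathcomp Require Export all_classical all_reals all_analysis.
From mathcomp.real_closed Require Export complex.
Export numFieldNormedType.Exports.

Set Implicit Arguments.
Unset Strict Implicit.
Unset Printing Implicit Defensive.

Import Order.TTheory GRing.Theory Num.Theory.
Local Open Scope classical_set_scope.
Local Open Scope ring_scope.

(* Sequences are indexed from 0 instead of 1.  A functional is a bundled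
   linear map into the scalars K, seen as the normed module K^o. *)

Section Frames.
Variables (K : numFieldType) (X : normedModType K).

Definition in_dual (phi : {linear X -> K^o}) : Prop := continuous phi.

Definition frame_terms (f : nat -> {linear X -> K^o}) (tau : nat -> X) (x : X)
  : nat -> X := fun n => (f n x : K) *: tau n.

Definition frame_converges (f : nat -> {linear X -> K^o}) (tau : nat -> X)
  : Prop := forall x, cvgn (series (frame_terms f tau x)).

(* Meaningful when [frame_converges f tau] holds: [limn] is a total function. *)
Definition frame_operator (f : nat -> {linear X -> K^o}) (tau : nat -> X)
  (x : X) : X := limn (series (frame_terms f tau x)).

Definition bounded_linear (T : X -> X) : Prop :=
  linear T /\ exists M : K, forall x, `|T x| <= M * `|x|.

Definition approximate_Bessel (f : nat -> {linear X -> K^o}) (tau : nat -> X)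
  : Prop :=
  [/\ forall n, in_dual (f n), frame_converges f tau
    & bounded_linear (frame_operator f tau)].

(* Invertibility is that of the map: on a Banach space, the inverse of a
   bounded bijective linear operator is bounded. *)
Definition expandable_to_ASF (f : nat -> {linear X -> K^o}) (tau : nat -> X)
  : Prop :=
  exists (g : nat -> {linear X -> K^o}) (omega : nat -> X),
    let S := fun x => frame_operator f tau x + frame_operator g omega x in
    [/\ forall n, in_dual (g n),
        frame_converges f tau /\ frame_converges g omega,
        bounded_linear S
      & bijective S].

End Frames.

Definition reconstruction_property (K : numFieldType) (X : normedModType K)
  : Prop :=
  exists (tau : nat -> X) (f : nat -> {linear X -> K^o}),
    (forall n, in_dual (f n)) /\
    forall x, series (frame_terms f tau x) @ \oo --> x.

(* Main.v *)
(* Write S for the frame operator of (f, tau). If x = sum_n h_n(x) rho_n for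
   all x, then adjoining h_n and omega_n = rho_n - S rho_n adds the operator
   I - S, so that the total frame operator is the identity. Conversely, let T
   be an invertible frame operator of an expansion. By the open mapping
   theorem T^-1 is continuous, so applying it termwise to the interleaved
   series for T x reconstructs x = T^-1 (T x). The open mapping theorem is
   proved over an arbitrary archimedean numeric field, which covers both R
   and R[i]. *)

From HB Require Import structures.
Require Import Defs.
From mathcomp Require Import ring.

Set Implicit Arguments.
Unset Strict Implicit.
Unset Printing Implicit Defensive.

Import Order.TTheory GRing.Theory Num.Theory.
Local Open Scope classical_set_scope.
Local Open Scope ring_scope.

(** * Archimedean estimates and Baire's theorem *)

Lemma archimedean_inv_lt (K : numFieldType) (archiK : Num.archimedean_axiom K)
  (e : K) : 0 < e -> exists n : nat, n.+1%:R^-1 < e.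
Proof.
move=> e0; have [n en] := archiK e^-1; exists n.
rewrite -(invrK e) ltf_pV2 ?posrE ?invr_gt0//.
by rewrite (lt_trans (le_lt_trans (real_ler_norm _) en)) ?ltr_nat//
  realE invr_ge0 (ltW e0).
Qed.

Lemma half_expr_lt (K : numFieldType) (archiK : Num.archimedean_axiom K)
  (e : K) : 0 < e -> exists n : nat, 2^-1 ^+ n < e.
Proof.
move=> /(archimedean_inv_lt archiK)[n ne]; exists n; apply: le_lt_trans ne.
by rewrite exprVn lef_pV2 ?posrE ?exprn_gt0// -natrX ler_nat ltn_expl.
Qed.

(* Baire's theorem; the library has it over [realType] only, whereas the
   complex case needs [K = R[i]]. *)
Lemma closed_cover_ball (K : numFieldType) (archiK : Num.archimedean_axiom K)
    (U : completeNormedModType K) (C : nat -> set U) :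
  (forall n, closed (C n)) -> (forall y, exists n, C n y) ->
  exists n y (r : {posnum K}), ball y r%:num `<=` C n.
Proof.
move=> clC covC; apply: contrapT => noball.
(* A pair is a centre and a radius. The ball of [q] with doubled radius must lie in the ball of [p]
   and miss [C n]; the doubling absorbs the passage to the limit of the centres. *)
pose P n (p q : U * {posnum K}) :=
  (forall z, `|q.1 - z| < 2 * q.2%:num -> `|p.1 - z| < p.2%:num /\ ~ C n z) /\
  q.2%:num <= n.+1%:R^-1.
have /choice[next nextP] : forall np : nat * (U * {posnum K}),
    exists q, P np.1 np.2 q.
  move=> [n [y r]].
  have [y' [yy' Cy']] : exists y', ball y r%:num y' /\ ~ C n y'.
    apply: contrapT => nex; apply: noball; exists n, y, r => z yz.
    by apply: contrapT => Cz; apply: nex; exists z.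
  have : nbhs y' (ball y r%:num `&` ~` C n).
    apply: open_nbhs_nbhs; split=> //.
    by apply: openI; [exact: ball_open|exact: closed_openC].
  move=> /nbhs_ballP[e /= e0 sub].
  have [d [de dn]] : exists d : {posnum K}, d%:num <= e / 2 /\
      d%:num <= n.+1%:R^-1.
    have e20 : 0 < e / 2 by rewrite divr_gt0.
    have n0 : 0 < n.+1%:R^-1 :> K by [].
    (* The order of [K] is partial; both bounds are real, hence comparable, and [d] is the smaller
       one. *)
    have [en|/ltW ne] := real_leP (gtr0_real e20) (gtr0_real n0).
      by exists (PosNum e20).
    by exists (PosNum n0).
  exists (y', d); split => //= z yz.
  move: sub => /(_ z); rewrite -!ball_normE /=; apply.
  by rewrite (lt_le_trans yz)// mulrC -ler_pdivlMr.
pose fix s n := if n is m.+1 then next (m, s m) else (0 : U, PosNum ltr01).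
have sP n : P n (s n) (s n.+1) by exact: (nextP (n, s n)).
pose a n := (s n).1; pose r n := (s n).2%:num.
have r0 n : 0 < r n by rewrite /r.
have nest n m z : (n <= m)%N -> `|a m - z| < r m -> `|a n - z| < r n.
  elim: m => [|m IH]; first by rewrite leqn0 => /eqP ->.
  rewrite leq_eqVlt => /predU1P[-> //|nm] amz; apply: IH => //.
  apply: (proj1 ((sP m).1 z _)); rewrite (lt_trans amz)//.
  by rewrite ltr_pMl ?ltr1n.
have aa n m : (n <= m)%N -> `|a n - a m| < r n.
  by move=> nm; apply: (nest _ m) => //; rewrite subrr normr0.
have : cvg (a @ \oo).
  apply: cauchy_cvg; apply: cauchy_exP => e /(archimedean_inv_lt archiK)[n ne].
  exists (a n.+1), n.+1 => // m nm; rewrite -ball_normE /=.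
  by rewrite (lt_trans (aa _ _ nm))// (le_lt_trans (sP n).2).
move=> /cvg_ex[l al]; have [n Cnl] := covC l.
(* A late centre is within [r n.+1] of both [l] and [a n.+1], so [l] lies in the doubled ball around
   [a n.+1], which misses [C n]. *)
apply: (proj2 ((sP n).1 l _)) => //; rewrite -/(a n.+1) -/(r n.+1).
have /cvgrPdist_lt/(_ _ (r0 n.+1))[m _ ml] := al.
have := ml _ (leq_maxl m n.+1); rewrite /= distrC => h.
by rewrite (le_lt_trans (ler_distD (a (maxn m n.+1)) _ _))//
  mulrDl !mul1r ltrD// aa// leq_maxr.
Qed.

(** * The open mapping theorem *)

(** By Baire, the closure of the image of some ball contains a ball. Subtracting its centre moves
    that ball to the origin, and homogeneity then reaches every [y]. *)
Lemma surj_approx_preimage (K : numFieldType)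
    (archiK : Num.archimedean_axiom K)
    (U : normedModType K) (V : completeNormedModType K) (T : {linear U -> V}) :
  (forall y, exists x, T x = y) ->
  exists2 M : K, 0 < M & forall y e, 0 < e ->
    exists2 x, `|x| <= M * `|y| & `|y - T x| < e.
Proof.
move=> Tsurj; pose C n := closure (T @` [set x | `|x| <= n%:R]).
have Capprox n y : C n y -> forall e, 0 < e ->
    exists2 x, `|x| <= n%:R & `|y - T x| < e.
  move=> Cy e e0; have [_ [[x xn <-]]] := Cy _ (nbhsx_ballx y e e0).
  by rewrite -ball_normE; exists x.
have [||n [y0 [r sub]]] := @closed_cover_ball _ archiK V C.
- by move=> n; exact: closed_closure.
- move=> y; have [x <-] := Tsurj y; have [n xn] := archiK `|x|.
  exists n; apply: subset_closure; exists x => //=.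
  by rewrite -(normr_id x) ltW.
have Cball z : `|y0 - z| < r%:num -> C n z.
  by move=> zr; apply: sub; rewrite -ball_normE.
have approx z : `|z| < r%:num -> forall e, 0 < e ->
    exists2 x, `|x| <= n%:R + n%:R & `|z - T x| < e.
  (* Here [z] is the difference of [y0 + z] and [y0], both in the ball; subtracting their
     approximate preimages doubles the norm bound. *)
  move=> zr e e0; have e20 : 0 < e / 2 by rewrite divr_gt0.
  have [|x1 x1n x1e] := Capprox n (y0 + z) _ _ e20.
    by apply: Cball; rewrite opprD addrA subrr sub0r normrN.
  have [|x2 x2n x2e] := Capprox n y0 _ _ e20.
    by apply: Cball; rewrite subrr normr0.
  exists (x1 - x2); first by rewrite (le_trans (ler_normB _ _))// lerD.
  have -> : z - T (x1 - x2) = (y0 + z - T x1) - (y0 - T x2).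
    by rewrite linearB -(addrA y0) (opprD y0) addrACA subrr add0r opprD addrA.
  by rewrite (le_lt_trans (ler_normB _ _))// (splitr e) ltrD.
have r0 : 0 < r%:num by [].
(* A vector of norm [r / 2] has approximate preimages of norm at most [n + n], and [y] is rescaled
   to that norm. Using [n.+1] keeps the constant positive when [n] is 0. *)
exists ((n.+1%:R + n.+1%:R) / (r%:num / 2)).
  by rewrite divr_gt0// ?addr_gt0 ?divr_gt0.
move=> y e e0; have [->|y_neq0] := eqVneq y 0.
  by exists 0; rewrite ?(linear0 T) ?subrr !normr0 ?mulr0.
pose c := r%:num / 2 / `|y|.
have c0 : 0 < c by rewrite !divr_gt0 ?normr_gt0.
have cy : c * `|y| = r%:num / 2 by rewrite divfK ?normr_eq0.
have [||x xn xe] := approx (c *: y) _ (c * e); last 1 first.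
- exists (c^-1 *: x).
    rewrite normrZ gtr0_norm ?invr_gt0// ler_pdivrMl//.
    rewrite mulrCA cy divfK ?gt_eqF ?divr_gt0//.
    by rewrite (le_trans xn)// lerD ?ler_nat.
  have -> : y - T (c^-1 *: x) = c^-1 *: (c *: y - T x).
    by rewrite linearZ/= scalerBr scalerA mulVf ?gt_eqF// scale1r.
  by rewrite normrZ gtr0_norm ?invr_gt0// ltr_pdivrMl.
- rewrite normrZ gtr0_norm// cy ltr_pdivrMr//.
  by rewrite ltr_pMr// ltr1n.
- by rewrite mulr_gt0.
Qed.

(** Approximate preimages are corrected repeatedly: each correction at least halves the residual, so
    the corrections are dominated by a geometric series and completeness sums them to an exact
    preimage. *)
Lemma surj_bounded_preimage (K : numFieldType)
    (archiK : Num.archimedean_axiom K)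
    (U V : completeNormedModType K) (T : {linear U -> V}) :
  continuous T -> (forall y, exists x, T x = y) ->
  exists M : K, forall y, exists2 x, `|x| <= M * `|y| & T x = y.
Proof.
move=> Tcont /(surj_approx_preimage archiK)[M M0 approx].
have half_gt0 : 0 < 2^-1 :> K by [].
have /choice[g gP] y : exists x,
    `|x| <= M * `|y| /\ `|y - T x| <= 2^-1 * `|y|.
  have [->|y0] := eqVneq y 0.
    by exists 0; rewrite (linear0 T) subrr !normr0 !mulr0.
  have [|x xM xe] := approx y (2^-1 * `|y|).
    by rewrite mulr_gt0 ?normr_gt0.
  by exists x; split=> //; exact: ltW.
(* The partial sums contribute [2 * M]; the extra 1 pays for replacing the limit by a partial sum at
   distance less than [|y|]. *)
exists (2 * M + 1) => y; have [->|y0] := eqVneq y 0.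
  by exists 0; rewrite ?(linear0 T)// !normr0 mulr0.
pose z := fix z n := if n is m.+1 then z m - T (g (z m)) else y.
have zE n : `|z n| <= 2^-1 ^+ n * `|y|.
  elim: n => [|n IH]; first by rewrite expr0 mul1r.
  rewrite (le_trans (gP _).2)// exprS -mulrA ler_pM2l//.
pose s := series (fun n => g (z n)).
have Ts n : T (s n) = y - z n.
  elim: n => [|n IH]; first by rewrite /s /series/= big_geq// linear0 subrr.
  by rewrite /s seriesSr linearD/= -/(s n) IH opprB addrA addrAC.
(* The right-hand side is the closed form of the geometric sum of the bounds [M * 2^-1 ^+ i * |y|]
   for [i] from [n] to [n + k - 1]. *)
have sB n k : `|s (n + k)%N - s n| <=
    2 * M * `|y| * (2^-1 ^+ n - 2^-1 ^+ (n + k)).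
  elim: k => [|k IH]; first by rewrite addn0 !subrr normr0 mulr0.
  rewrite addnS /s seriesSr -/(s _) addrAC (le_trans (ler_normD _ _))//.
  apply: (le_trans (lerD IH (le_trans (gP _).1 _))).
    by apply: ler_wpM2l (zE _); exact: ltW.
  rewrite exprS le_eqVlt; apply/orP; left; apply/eqP.
  by field; rewrite ?pnatr_eq0.
have sC n m : (n <= m)%N -> `|s n - s m| <= 2 * M * `|y| * 2^-1 ^+ n.
  move=> /subnKC <-; rewrite distrC (le_trans (sB _ _))// ler_wpM2l//.
    by rewrite !mulr_ge0// ltW.
  by rewrite gerBl exprn_ge0// ltW.
have My0 : 0 < 2 * M * `|y| by rewrite !mulr_gt0 ?normr_gt0.
have : cvg (s @ \oo).
  apply: cauchy_cvg; apply: cauchy_exP => e e0.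
  have [|n ne] := half_expr_lt archiK (e := e / (2 * M * `|y|)).
    by rewrite divr_gt0.
  exists (s n), n => // m nm; rewrite -ball_normE /=.
  by rewrite (le_lt_trans (sC _ _ nm))// mulrC -ltr_pdivlMr.
move=> /cvg_ex[l sl]; exists l.
  have /cvgrPdist_lt/(_ `|y|)[|n _ nl] := sl; first by rewrite normr_gt0.
  rewrite -(subrK (s n) l) addrC mulrDl mul1r (le_trans (ler_normD _ _))//.
  rewrite lerD//; last exact/ltW/nl/leqnn.
  have := sC 0%N n (leq0n n).
  by rewrite {1}/s /series/= big_geq// sub0r normrN expr0 mulr1.
(* The images [T (s n)] tend to [T l] by continuity and to [y] because the residuals vanish. *)
have Tsl : T \o s @ \oo --> T l by exact: (cvg_comp _ _ sl (Tcont l)).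
apply: (cvg_unique (@norm_hausdorff _ _) Tsl).
apply/cvgrPdist_lt => e e0.
have [|k ke] := half_expr_lt archiK (e := e / `|y|).
  by rewrite divr_gt0 ?normr_gt0.
exists k => // m km /=; rewrite Ts opprB addrC subrK.
rewrite (le_lt_trans (zE m))// -ltr_pdivlMr ?normr_gt0// (le_lt_trans _ ke)//.
by rewrite ler_wiXn2l// ?ltW// invf_lt1 ?ltr1n.
Qed.

(** * Interleaved series and bounded operators *)

(** An expansion adds two separate series, whereas reconstruction asks for a single one. The first
    [m] interleaved terms comprise [uphalf m] terms of [a] and [half m] terms of [b]. *)
Lemma cvg_series_interleave (K : numFieldType) (V : normedModType K)
    (a b : nat -> V) (A B : V) :
  series a @ \oo --> A -> series b @ \oo --> B ->
  series (fun n => if odd n then b n./2 else a n./2) @ \oo --> A + B.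
Proof.
move=> aA bB.
have -> : series (fun n => if odd n then b n./2 else a n./2) =
    (series a \o uphalf) \+ (series b \o half).
  apply/funext => m /=; elim: m => [|m IH].
    by rewrite /series/= !big_geq// addr0.
  rewrite seriesSr IH /=; have := uphalf_half m; case: ifP => _ ->.
    by rewrite add1n [series b _.+1]seriesSr addrA.
  by rewrite add0n [series a _.+1]seriesSr addrAC.
apply: cvgD; [apply: cvg_comp aA|apply: cvg_comp bB] => S [n _ nS];
  exists n.*2 => // m /= nm; apply: nS => /=.
  by rewrite geq_uphalf_double leqW.
by rewrite geq_half_double.
Qed.

Definition linear_pack (K : numFieldType) (X : normedModType K) (T : X -> X)
    (lT : linear T) : {linear X -> X} :=
  HB.pack T (GRing.isLinear.Build _ _ _ _ _ lT).

Lemma continuous_bounded_linear (K : numFieldType) (X : normedModType K)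
    (T : X -> X) :
  bounded_linear T -> continuous T.
Proof.
move=> [lT [M TM]].
apply: (@bounded_linear_continuous _ _ _ (linear_pack lT)).
(* The constant [M] is not assumed real, but its norm is. *)
apply/linear_boundedP; exists `|M|; split=> [|r Mr x]; first exact: normr_real.
rewrite (le_trans (TM x))// (le_trans _ (ler_wpM2r _ (ltW Mr)))//.
rewrite -[leRHS](ger0_norm) ?mulr_ge0// normrM normr_id -normrM.
by rewrite ger0_norm// (le_trans _ (TM x)).
Qed.

Lemma series_frame_terms_image (K : numFieldType) (X : normedModType K)
    (T : X -> X) (f : nat -> {linear X -> K^o}) (tau : nat -> X) (x : X) :
  linear T ->
  series (frame_terms f (T \o tau) x) = T \o series (frame_terms f tau x).
Proof.
move=> lT; pose L := linear_pack lT.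
apply/funext => n; rewrite /series /= -[T _]/(L _) (linear_sum L).
by apply: eq_bigr => i _; rewrite /frame_terms (linearZ_LR L).
Qed.

(** * The two implications *)

Lemma reconstruction_expandable (K : numFieldType) (X : normedModType K)
    (f : nat -> {linear X -> K^o}) (tau : nat -> X) :
  approximate_Bessel f tau -> reconstruction_property X ->
  expandable_to_ASF f tau.
Proof.
move=> [fdual fcvg Sbl] [rho [h [hdual hrho]]].
have Scont := continuous_bounded_linear Sbl; have [lS _] := Sbl.
set S := frame_operator f tau in Sbl Scont lS.
have lIS : linear (fun x => x - S x).
  by move=> c x y; rewrite lS scalerBr opprD addrACA.
pose omega := (fun x => x - S x) \o rho.
(* The partial sums are the images under [I - S] of those of the reconstruction series, so
   continuity of [S] gives the limit. *)
have hcvg x : series (frame_terms h omega x) @ \oo --> x - S x.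
  rewrite series_frame_terms_image//.
  apply: cvgB; first exact: hrho.
  exact: (cvg_comp _ _ (hrho x) (Scont x)).
have E : (fun x => frame_operator f tau x + frame_operator h omega x) = id.
  apply/funext => x; rewrite {2}/frame_operator (cvg_lim _ (hcvg x))//.
  by rewrite addrC subrK.
exists h, omega => /=; rewrite E; split=> //.
- by split=> // x; apply/cvg_ex; exists (x - S x); exact: hcvg.
- by split; [|exists 1 => x; rewrite mul1r].
- by exists id.
Qed.

Lemma expandable_reconstruction (K : numFieldType)
    (archiK : Num.archimedean_axiom K) (X : completeNormedModType K)
    (f : nat -> {linear X -> K^o}) (tau : nat -> X) :
  approximate_Bessel f tau -> expandable_to_ASF f tau ->
  reconstruction_property X.
Proof.
move=> [fdual _ _] [g [omega /= [gdual [fcvg gcvg] Tbl [Ti TiK TK]]]].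
set T := (fun x => _) in Tbl TiK TK.
have Tcont := continuous_bounded_linear Tbl; have [lT _] := Tbl.
have lTi : linear Ti.
  by move=> c x y; apply: (can_inj TiK); rewrite lT !TK.
have [|M TM] :=
    @surj_bounded_preimage _ archiK X X (linear_pack lT) Tcont.
  by move=> y; exists (Ti y); exact: TK.
have Ticont : continuous Ti.
  apply: continuous_bounded_linear; split=> //; exists M => y.
  (* By injectivity, the preimage of controlled norm is [Ti y] itself. *)
  by have [x xM Txy] := TM y; rewrite -{1}Txy [Ti _]TiK.
pose alt (V : Type) (a b : nat -> V) n := if odd n then b n./2 else a n./2.
exists (alt _ (Ti \o tau) (Ti \o omega)), (alt _ f g); split=> [n|x].
  by rewrite /alt; case: ifP.
have -> : frame_terms (alt _ f g) (alt _ (Ti \o tau) (Ti \o omega)) x =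
    alt _ (frame_terms f (Ti \o tau) x) (frame_terms g (Ti \o omega) x).
  by apply/funext => n; rewrite /frame_terms /alt; case: ifP.
have TiTx : Ti (frame_operator f tau x) + Ti (frame_operator g omega x) = x.
  by rewrite -[RHS]TiK [RHS](linearD (linear_pack lTi)).
rewrite -[X in _ --> X]TiTx.
apply: cvg_series_interleave; rewrite series_frame_terms_image//.
  exact: (cvg_comp _ _ (fcvg x) (Ticont _)).
exact: (cvg_comp _ _ (gcvg x) (Ticont _)).
Qed.

(** The norm of a complex number is the image of a real modulus, so the real archimedean bound
    transfers. *)
Lemma archimedean_complex (R : realType) : Num.archimedean_axiom (complex R).
Proof.
move=> z.
exists (Num.truncn (Num.sqrt (complex.Re z ^+ 2 + complex.Im z ^+ 2))).+1.
rewrite normc_def -(rmorph_nat (real_complex R)) ltcR.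
exact: truncnS_gt.
Qed.

Theorem theorem2p5 (R : realType) :
  (forall (X : completeNormedModType R)
      (f : nat -> {linear X -> R^o}) (tau : nat -> X),
    approximate_Bessel f tau ->
    (expandable_to_ASF f tau <-> reconstruction_property X)) /\
  (forall (X : completeNormedModType (complex R))
      (f : nat -> {linear X -> (complex R)^o}) (tau : nat -> X),
    approximate_Bessel f tau ->
    (expandable_to_ASF f tau <-> reconstruction_property X)).
Proof.
split=> X f tau fB; split; try exact: reconstruction_expandable.
- apply: expandable_reconstruction fB => x.
  by exists (Num.truncn `|x|).+1; exact: truncnS_gt.
- exact: expandable_reconstruction (@archimedean_complex R) _ _ _ fB.
Qed.
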